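(* Consider the closed-loop system, for $t\in\mathbb{Z}_+$, $$X_{t+1}=\mathcal{A}(X_t)+\mathcal{B}\bigl(\Theta\Psi(X_t,t)+U_t\bigr),\qquad U_t=-\mathcal{K}(X_t)-\widehat{\Theta}_t\Psi(X_t,t)+U_t^{\mathrm d},$$ with arbitrary initial state $X_0\in\mathbb{R}^{n_1\times n_2}$, where the estimates $\widehat\Theta_t$ are generated, from an initial estimate $\widehat{\Theta}_0$ with $\partial f(\widehat\Theta_0)\neq\varnothing$ and any $Z_0\in\partial f(\widehat{\Theta}_0)$, by $$Z_{t+1}=Z_t-\eta_{t+1}\nabla J_t(\widehat{\Theta}_t),\qquad \widehat{\Theta}_{t+1}=\nabla f^*(Z_{t+1}),\qquad \eta_{t+1}=\frac{2\mu J_t(\widehat{\Theta}_t)}{\epsilon_{t+1}+\|\nabla J_t(\widehat{\Theta}_t)\|_*^2},$$ for a nonnegative bounded sequence $\{\epsilon_{t+1}\}_{t\in\mathbb{Z}_+}$. Then for every integer $T\ge1$ the regret $\operatorname{Reg}(T):=\sum_{t=0}^{T-1}J_t(\widehat\Theta_t)$ satisfies $$\operatorname{Reg}(T)\le\sqrt{\frac{D_f(\Theta,\widehat\Theta_0;Z_0)}{2\mu}\sum_{t=0}^{T-1}\left(\epsilon_{t+1}+\|\nabla J_t(\widehat\Theta_t)\|_*^2\right)} .$$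
   Context: Fix positive integers $n_1,n_2,m,k$. Matrix spaces carry the Frobenius inner product $\langle X,Y\rangle=\operatorname{Tr}(X^\top Y)$ and Frobenius norm $\|\cdot\|_{\mathrm F}$. $\mathcal{A}:\mathbb{R}^{n_1\times n_2}\to\mathbb{R}^{n_1\times n_2}$, $\mathcal{B}:\mathbb{R}^{m\times n_2}\to\mathbb{R}^{n_1\times n_2}$ and $\mathcal{K}:\mathbb{R}^{n_1\times n_2}\to\mathbb{R}^{m\times n_2}$ are linear operators such that $\mathcal{A}-\mathcal{B}\mathcal{K}$ (i.e. $X\mapsto\mathcal{A}(X)-\mathcal{B}(\mathcal{K}(X))$) is Schur stable (spectral radius $<1$). $\mathcal{B}^\top$ is the adjoint of $\mathcal{B}$: $\langle\mathcal{B}(U),V\rangle=\langle U,\mathcal{B}^\top(V)\rangle$. $\Psi:\mathbb{R}^{n_1\times n_2}\times\mathbb{Z}_+\to\mathbb{R}^{k\times n_2}$ is a map (the regressor), $\{U_t^{\mathrm d}\}_{t\in\mathbb{Z}_+}\subset\mathbb{R}^{m\times n_2}$ is a bounded sequence, and $\Theta\in\Omega\subseteq\mathbb{R}^{m\times k}$ is the fixed true parameter. Residual, loss and gradient: $$\widetilde X_{t+1}:=X_{t+1}-(\mathcal{A}-\mathcal{B}\mathcal{K})(X_t)-\mathcal{B}(U_t^{\mathrm d})=\mathcal{B}\bigl((\Theta-\widehat\Theta_t)\Psi(X_t,t)\bigr),$$ $$J_t(\widehat\Theta_t):=\tfrac12\bigl\|\mathcal{B}\bigl((\Theta-\widehat\Theta_t)\Psi(X_t,t)\bigr)\bigr\|_{\mathrm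 F}^2=\tfrac12\|\widetilde X_{t+1}\|_{\mathrm F}^2,\qquad \nabla J_t(\widehat\Theta_t)=-\mathcal{B}^\top(\widetilde X_{t+1})\Psi(X_t,t)^\top .$$ Mirror map: $\|\cdot\|$ is a norm on $\mathbb{R}^{m\times k}$ with dual norm $\|Z\|_*=\sup\{\langle Z,X\rangle:\|X\|\le1\}$. $f:\mathbb{R}^{m\times k}\to\mathbb{R}\cup\{+\infty\}$ is proper, lower semicontinuous, convex, with $\Omega\subseteq\operatorname{dom}f$ (so $\Theta\in\operatorname{dom} f$), not necessarily differentiable, and $\mu$-strongly convex ($\mu>0$) with respect to $\|\cdot\|$: $f(P)\ge f(Q)+\langle Z,P-Q\rangle+\frac\mu2\|P-Q\|^2$ for all $P,Q\in\operatorname{dom}f$ and $Z\in\partial f(Q)$. $f^*(Z)=\sup_{X\in\operatorname{dom}f}\{\langle Z,X\rangle-f(X)\}$ is its Fenchel conjugate, which is differentiable everywhere. The generalized Bregman divergence, for $P,Q\in\operatorname{dom}f$ and $Z\in\partial f(Q)$, is $D_f(P,Q;Z):=f(P)+f^*(Z)-\langle P,Z\rangle=f(P)-f(Q)-\langle P-Q,Z\rangle$. Convention: if the denominator in the step size is zero (in which case $J_t(\widehat\Theta_t)=0$ too), set $\eta_{t+1}=0$. *)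

(* Defs.v *)
From mathcomp Require Import all_boot all_order all_algebra.
From mathcomp Require Import all_classical all_reals all_analysis.
From mathcomp Require Import complex.

Set Implicit Arguments.
Unset Strict Implicit.
Unset Printing Implicit Defensive.

Import Order.TTheory GRing.Theory Num.Theory.
Import numFieldNormedType.Exports.

Local Open Scope classical_set_scope.
Local Open Scope ring_scope.

Section Matrices.
Context {R : realType} {p q : nat}.
Implicit Types X Y Z : 'M[R]_(p, q).

Definition frob_dot X Y : R := \tr (X^T *m Y).

Definition frob_norm X : R := Num.sqrt (frob_dot X X).

(* The library norm on matrices, which only provides the topology and the
   notion of differential here, is the max norm; an arbitrary norm on the
   parameter space is a function [N] satisfying [is_norm N]. *)
Definition is_norm (N : 'M[R]_(p, q) -> R) : Prop :=
  [/\ forall X Y, N (X + Y) <= N X + N Y,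
      forall (a : R) X, N (a *: X) = `|a| * N X
    & forall X, N X = 0 -> X = 0].

(* The set is nonempty and bounded when [N] is a norm, so the real-valued
   [sup] is a genuine supremum. *)
Definition dual_norm (N : 'M[R]_(p, q) -> R) Z : R :=
  sup [set frob_dot Z X | X in [set X | N X <= 1]].

(* The matrix G with 'd g X V = frob_dot G V for all V, where g is
   differentiable at X. *)
Definition gradient (g : 'M[R]_(p, q) -> R) X : 'M[R]_(p, q) :=
  \matrix_(i, j) ('d g X (delta_mx i j) : R).

(* [lin_mx F] is the matrix of F acting on vectorised matrices; it is mapped
   to the complex numbers so that all complex eigenvalues are counted. *)
Definition spectral_radius (F : 'M[R]_(p, q) -> 'M[R]_(p, q)) : R :=
  sup [set ComplexField.Normc.normc a | a in
        [set a : R[i] | eigenvalue (map_mx (real_complex R) (lin_mx F)) a]].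

Definition schur_stable (F : 'M[R]_(p, q) -> 'M[R]_(p, q)) : Prop :=
  spectral_radius F < 1.

End Matrices.

Section ConvexAnalysis.
Context {R : realType} {p q : nat}.
Local Open Scope ereal_scope.
Implicit Types (f : 'M[R]_(p, q) -> \bar R) (P Q X Z : 'M[R]_(p, q)).

Definition dom f : set 'M[R]_(p, q) := [set X | f X < +oo].

Definition proper_fun f : Prop :=
  (forall X, f X != -oo) /\ dom f !=set0.

Definition econvex f : Prop :=
  forall X Y (t : R), (0 <= t <= 1)%R ->
    f (t *: X + (1 - t) *: Y)%R <= t%:E * f X + (1 - t)%:E * f Y.

Definition subdiff f Q : set 'M[R]_(p, q) :=
  [set Z | forall P, f Q + (frob_dot Z (P - Q))%:E <= f P].

Definition strongly_convex (N : 'M[R]_(p, q) -> R) (mu : R) f : Prop :=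
  forall P Q Z, dom f P -> dom f Q -> subdiff f Q Z ->
    f Q + (frob_dot Z (P - Q))%:E + (mu / 2 * N (P - Q) ^+ 2)%:E <= f P.

Definition fenchel f Z : \bar R :=
  ereal_sup [set (frob_dot Z X)%:E - f X | X in dom f].

(* D_f(P, Q; Z), meant for P, Q in the domain of f and Z in the
   subdifferential of f at Q.  By Fenchel's equality at (Q, Z) it is then
   f P - f Q - <P - Q, Z>; as written, Q enters only through Z. *)
Definition bregman f P Q Z : \bar R :=
  f P + fenchel f Z - (frob_dot P Z)%:E.

End ConvexAnalysis.

Section Adaptation.
Context {R : realType} {n1 n2 m k : nat}.
Variables (B : 'M[R]_(m, n2) -> 'M[R]_(n1, n2)) (Theta : 'M[R]_(m, k)).

(* The loss J_t as a function of the estimate; [psi] is the value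
   Psi (X_t, t) of the regressor. *)
Definition loss (psi : 'M[R]_(k, n2)) (That : 'M[R]_(m, k)) : R :=
  2^-1 * frob_norm (B ((Theta - That) *m psi)) ^+ 2.

Definition loss_grad (psi : 'M[R]_(k, n2)) (That : 'M[R]_(m, k)) :
    'M[R]_(m, k) :=
  gradient (loss psi) That.

Definition step_size (N : 'M[R]_(m, k) -> R) (mu eps : R)
    (psi : 'M[R]_(k, n2)) (That : 'M[R]_(m, k)) : R :=
  let d := eps + dual_norm N (loss_grad psi That) ^+ 2 in
  if d == 0 then 0 else 2 * mu * loss psi That / d.

End Adaptation.

(* Main.v *)
Require Import Defs.
From HB Require Import structures.
From mathcomp Require Import all_boot all_order all_algebra.
From mathcomp Require Import all_classical all_reals all_analysis.
From mathcomp Require Import ring lra.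

Import Order.TTheory GRing.Theory Num.Theory.
Import numFieldNormedType.Exports.

Local Open Scope classical_set_scope.
Local Open Scope ring_scope.

Set Implicit Arguments.
Unset Strict Implicit.
Unset Printing Implicit Defensive.

(** The estimates are mirror descent iterates, and the right-hand side is what
    a Lyapunov argument with V_t = D_f(Theta, That_t; Z_t) yields.  Two facts
    drive it.

    - The loss is half a squared norm of a quantity linear in the error
      Theta - That, so moving from That to Theta changes it at the exact first
      order rate <grad J, Theta - That> = - 2 J ([frob_dot_loss_grad_error]).
    - Strong convexity of f is smoothness of its conjugate: if Z is a
      subgradient at Q, then f^*(Z + W) <= f^*(Z) + <W, Q> + |W|_*^2 / (2 mu)
      ([fenchel_smooth]).

    Together they give V_(t+1) <= V_t - 2 eta J + eta^2 |grad J|_*^2 / (2 mu),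
    and the step size is chosen so that the last term is at most eta J
    ([mirror_descent_step]).  Hence the sum of the eta J is at most V_0, because
    V stays nonnegative by the Fenchel-Young inequality.  Since eta d = 2 mu J,
    where d is the denominator of the step size, J^2 is the product of
    eta J / (2 mu) and d, and the Cauchy-Schwarz inequality ([sqr_sum_le])
    finishes the proof.

    Smoothness needs Z_t to be a subgradient of f at That_t for every t, not
    only for t = 0, whereas That_(t+1) is merely defined as the gradient of f^*
    at Z_(t+1).  The one given subgradient makes f grow quadratically, so
    f - <Z, .> attains its minimum for every Z: every Z is a subgradient
    somewhere ([subdiff_surjective]).  If it is one at Q, then f^* - <., Q>
    varies only quadratically near Z, so that f^* is differentiable at Z with
    gradient Q ([gradient_fenchel]).  The compactness and the
    differentiability used here refer to the max norm on matrices, which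
    requires the equivalence of norms in finite dimension. *)

(** * The Frobenius inner product *)

Section MatrixNorms.
Context {R : realType} {p q : nat}.
Implicit Types (X Y Z V : 'M[R]_(p, q)) (N : 'M[R]_(p, q) -> R).

Lemma frob_dotE X Y : frob_dot X Y = \sum_i \sum_j X i j * Y i j.
Proof.
rewrite /frob_dot /mxtrace exchange_big /=; apply: eq_bigr => j _.
by rewrite mxE; apply: eq_bigr => i _; rewrite mxE.
Qed.

Lemma frob_dotC X Y : frob_dot X Y = frob_dot Y X.
Proof.
by rewrite !frob_dotE; do 2!(apply: eq_bigr => ? _); rewrite mulrC.
Qed.

Lemma frob_dot_is_linear X : linear (frob_dot X : 'M[R]_(p, q) -> R^o).
Proof.
move=> a Y Z; rewrite !frob_dotE scaler_sumr -big_split; apply: eq_bigr => i _.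
rewrite scaler_sumr -big_split; apply: eq_bigr => j _.
by rewrite /= !mxE mulrDr mulrCA.
Qed.

HB.instance Definition _ X :=
  GRing.isLinear.Build R 'M[R]_(p, q) R^o *:%R (frob_dot X)
    (frob_dot_is_linear X).

Lemma frob_dotDr X Y Z : frob_dot X (Y + Z) = frob_dot X Y + frob_dot X Z.
Proof. exact: (linearD (frob_dot X)). Qed.

Lemma frob_dotBr X Y Z : frob_dot X (Y - Z) = frob_dot X Y - frob_dot X Z.
Proof. exact: (linearB (frob_dot X)). Qed.

Lemma frob_dotZr a X Y : frob_dot X (a *: Y) = a * frob_dot X Y.
Proof. exact: (linearZZ (frob_dot X)). Qed.

Lemma frob_dotNr X Y : frob_dot X (- Y) = - frob_dot X Y.
Proof. exact: (linearN (frob_dot X)). Qed.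

Lemma frob_dotDl X Y Z : frob_dot (X + Y) Z = frob_dot X Z + frob_dot Y Z.
Proof. by rewrite frob_dotC frob_dotDr !(frob_dotC Z). Qed.

Lemma frob_dotBl X Y Z : frob_dot (X - Y) Z = frob_dot X Z - frob_dot Y Z.
Proof. by rewrite frob_dotC frob_dotBr !(frob_dotC Z). Qed.

Lemma frob_dotZl a X Y : frob_dot (a *: X) Y = a * frob_dot X Y.
Proof. by rewrite frob_dotC frob_dotZr (frob_dotC Y). Qed.

Lemma frob_dotNl X Y : frob_dot (- X) Y = - frob_dot X Y.
Proof. by rewrite frob_dotC frob_dotNr (frob_dotC Y). Qed.

Lemma frob_dot_ge0 X : 0 <= frob_dot X X.
Proof.
by rewrite frob_dotE; do 2!(apply: sumr_ge0 => ? _); rewrite -expr2 sqr_ge0.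
Qed.

Lemma sqr_frob_norm X : frob_norm X ^+ 2 = frob_dot X X.
Proof. by rewrite sqr_sqrtr// frob_dot_ge0. Qed.

(** Riesz representation: it turns a differential into a gradient matrix. *)
Lemma linear_frob_dot (L : {linear 'M[R]_(p, q) -> R^o}) V :
  L V = frob_dot (\matrix_(i, j) L (delta_mx i j)) V.
Proof.
rewrite [in LHS](matrix_sum_delta V) linear_sum frob_dotE.
apply: eq_bigr => i _; rewrite linear_sum; apply: eq_bigr => j _.
by rewrite linearZ mxE mulrC.
Qed.

(** * Comparison of norms *)

Lemma mx_coef_le_norm X i j : `|X i j| <= `|X|.
Proof.
rewrite [leRHS]/Num.norm /= mx_normrE; apply/bigmax_geP; right => /=.
by exists (i, j).
Qed.

Lemma mx_norm_le X (M : R) :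
  0 <= M -> (forall i j, `|X i j| <= M) -> `|X| <= M.
Proof.
move=> M0 XM; rewrite [leLHS]/Num.norm /= mx_normrE.
by apply/bigmax_leP; split=> // -[i j] _; exact: XM.
Qed.

Lemma seminorm0 N : (forall a X, N (a *: X) = `|a| * N X) -> N 0 = 0.
Proof. by move=> NZ; rewrite -(scale0r 0) NZ normr0 mul0r. Qed.

Lemma seminorm_ge0 N X :
    (forall X Y, N (X + Y) <= N X + N Y) ->
    (forall a X, N (a *: X) = `|a| * N X) ->
  0 <= N X.
Proof.
move=> ND NZ; have := ND X (- X).
rewrite subrr (seminorm0 NZ) -scaleN1r NZ normrN1 mul1r.
by rewrite -mulr2n pmulrn_lge0.
Qed.

(** Stated for seminorms because it also serves for a linear map followed by a
    norm, whose kernel may be nonzero. *)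
Lemma seminorm_bound N :
    (forall X Y, N (X + Y) <= N X + N Y) ->
    (forall a X, N (a *: X) = `|a| * N X) ->
  exists2 C : R, 0 <= C & forall X, N X <= C * `|X|.
Proof.
move=> ND NZ.
have N0 := seminorm0 NZ; have NN X := seminorm_ge0 X ND NZ.
have Nsum (I : finType) (F : I -> 'M[R]_(p, q)) :
    N (\sum_i F i) <= \sum_i N (F i).
  elim/big_ind2 : _ => [|X a Y b Xa Yb|//]; first by rewrite N0.
  by apply: le_trans (ND _ _) _; rewrite lerD.
exists (\sum_i \sum_j N (delta_mx i j)) => [|X].
  by do 2!(apply: sumr_ge0 => ? _).
rewrite [in leLHS](matrix_sum_delta X) mulr_suml.
apply: le_trans (Nsum _ _) _; apply: ler_sum => i _.
rewrite mulr_suml; apply: le_trans (Nsum _ _) _; apply: ler_sum => j _.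
by rewrite NZ mulrC ler_wpM2l// mx_coef_le_norm.
Qed.

(** A Cauchy-Schwarz inequality for the max norm, with C = p q. *)
Lemma frob_dot_bound :
  exists2 C : R, 0 <= C & forall X Y, `|frob_dot X Y| <= C * `|X| * `|Y|.
Proof.
exists (\sum_(i < p) \sum_(j < q) 1) => [|X Y].
  by do 2!(apply: sumr_ge0 => ? _).
rewrite frob_dotE !mulr_suml; apply: le_trans (ler_norm_sum _ _ _) _.
apply: ler_sum => i _.
apply: le_trans (ler_norm_sum _ _ _) _; apply: ler_sum => j _.
by rewrite normrM mul1r ler_pM// ?mx_coef_le_norm.
Qed.

End MatrixNorms.

Lemma lipschitz_continuous {R : realType} (V W : normedModType R) (g : V -> W)
    (C : R) :
  (forall x y, `|g x - g y| <= C * `|x - y|) -> continuous g.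
Proof.
move=> gC x; apply/cvgrPdist_le => e e0; near=> y.
apply: le_trans (gC x y) _.
have C1 : 0 < `|C| + 1 by rewrite ltr_wpDl.
apply: (@le_trans _ _ ((`|C| + 1) * `|x - y|)).
  by apply: ler_wpM2r => //; rewrite (le_trans (ler_norm C))// lerDl.
rewrite -ler_pdivlMl//.
near: y; apply: cvgr_dist_le; first exact: cvg_id.
by rewrite mulr_gt0// invr_gt0.
Unshelve. all: by end_near. Qed.

Section NormEquivalence.
Context {R : realType} {p q : nat}.
Implicit Types (X Y Z V : 'M[R]_(p, q)) (N : 'M[R]_(p, q) -> R).

Lemma mx_ball_compact (M : R) : compact [set X : 'M[R]_(p, q) | `|X| <= M].
Proof.
have [M0|M0] := ltP M 0.
  rewrite (_ : [set _ | _] = set0); first exact: compact0.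
  by apply/seteqP; split=> // X /= /(le_trans (normr_ge0 _)); rewrite leNgt M0.
have cvec : continuous (vec_mx : 'rV[R]_(p * q) -> 'M[R]_(p, q)).
  apply: (@lipschitz_continuous R 'rV[R]_(p * q) 'M[R]_(p, q) vec_mx 1) => u v.
  rewrite mul1r -linearB.
  by apply: mx_norm_le => // i j; rewrite mxE mx_coef_le_norm.
rewrite (_ : [set _ | _] =
    [set (vec_mx u : 'M[R]_(p, q)) | u in [set u : 'rV[R]_(p * q) |
      forall k, `[- M, M]%classic (u ord0 k)]]).
  apply: continuous_compact; first exact: continuous_subspaceT.
  apply: (@rV_compact R (p * q) (fun=> `[- M, M]%classic)) => k.
  exact: segment_compact.
apply/seteqP; split=> [X /= XM|_ /= [u uM <-]].
  exists (mxvec X); last exact: mxvecK.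
  move=> k; rewrite /= in_itv /= -ler_norml.
  case/mxvec_indexP: k => i j.
  by rewrite mxvecE (le_trans (mx_coef_le_norm _ _ _)).
apply: mx_norm_le => // i j; rewrite mxE ler_norml.
by have := uM (mxvec_index i j); rewrite /= in_itv.
Qed.

Lemma is_norm_ge0 N X : is_norm N -> 0 <= N X.
Proof. by case=> ND NZ _; exact: seminorm_ge0. Qed.

Lemma is_norm_continuous N : is_norm N -> continuous N.
Proof.
move=> [ND NZ _]; have [C _ NC] := seminorm_bound ND NZ.
apply: (@lipschitz_continuous R 'M[R]_(p, q) R^o N C) => X Y.
have NB U V : N U - N V <= C * `|U - V|.
  by rewrite lerBlDr (le_trans _ (lerD (NC _) (lexx _)))// -{1}(subrK V U).
by rewrite ler_norml lerNl opprB (distrC X) NB distrC NB.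
Qed.

(** The hard half of the equivalence of norms: by compactness N has a positive
    minimum on the max-norm sphere. *)
Lemma is_norm_lower_bound N : is_norm N ->
  exists2 C : R, 0 < C & forall X, `|X| <= C * N X.
Proof.
move=> Nn; have [ND NZ Nsep] := Nn.
pose S : set 'M[R]_(p, q) := [set X | `|X| = 1].
have normalize X : X != 0 -> S (`|X|^-1 *: X).
  by move=> X0; rewrite /S /= normrZ normfV normr_id mulVf// normr_eq0.
(* the sphere is empty when p or q is zero *)
have [[Y0 SY0]|Sempty] := pselect (S !=set0); last first.
  exists 1 => // X; rewrite mul1r; have [->|X0] := eqVneq X 0.
    by rewrite normr0 is_norm_ge0.
  by case: Sempty; exists (`|X|^-1 *: X); exact: normalize.
have cS : compact S.
  apply: (subclosed_compact _ (@mx_ball_compact 1)); last by move=> X /= ->.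
  have cnorm : continuous (fun X : 'M[R]_(p, q) => `|X| : R).
    by move=> X; exact: norm_continuous.
  by apply: (preimage_closed _ (@closed_eq R 1)) => X _; exact: cnorm.
have [Y /set_mem SY minY] :
    exists2 Y, Y \in S & forall X, X \in S -> N Y <= N X.
  apply: compact_EVT_min => //; first by exists Y0.
  by apply: continuous_subspaceT; exact: is_norm_continuous.
have NY : 0 < N Y.
  rewrite lt_def is_norm_ge0// andbT; apply/eqP => /Nsep Y_eq0.
  by move: SY; rewrite /S /= Y_eq0 normr0 => /eqP; rewrite eq_sym oner_eq0.
exists (N Y)^-1 => [|X]; first by rewrite invr_gt0.
have [->|X0] := eqVneq X 0.
  by rewrite normr0 mulr_ge0 ?invr_ge0 ?is_norm_ge0.
have := minY _ (mem_set (normalize X X0)).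
rewrite NZ normfV normr_id mulrC ler_pdivlMr ?normr_gt0//.
by rewrite ler_pdivlMl.
Qed.

Lemma frob_dot_norm_bound N : is_norm N ->
  exists2 C : R, 0 <= C & forall W X, `|frob_dot W X| <= C * `|W| * N X.
Proof.
move=> Nn; have [c c0 cN] := is_norm_lower_bound Nn.
have [C C0 fC] := @frob_dot_bound R p q.
exists (C * c) => [|W X]; first by rewrite mulr_ge0// ltW.
apply: le_trans (fC W X) _; rewrite (mulrAC C c) -(mulrA _ c).
by rewrite ler_wpM2l ?mulr_ge0.
Qed.

(** By the equivalence of norms the supremum defining the dual norm is taken
    over a bounded set, so it does bound every pairing. *)
Lemma frob_dot_le_dual_norm N Z X : is_norm N ->
  `|frob_dot Z X| <= dual_norm N Z * N X.
Proof.
move=> Nn; have [ND NZ Nsep] := Nn.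
have [C C0 fC] := frob_dot_norm_bound Nn.
(* both signs follow from one, applied to X and - X *)
wlog suff pos : X / frob_dot Z X <= dual_norm N Z * N X.
  rewrite ler_norml pos andbT lerNl -frob_dotNr (le_trans (pos _))//.
  by rewrite -scaleN1r NZ normrN1 mul1r.
have [NX0|NX0] := eqVneq (N X) 0.
  by rewrite (Nsep _ NX0) (linear0 (frob_dot Z)) -(Nsep _ NX0) NX0 mulr0.
have NX : 0 < N X by rewrite lt_def NX0 is_norm_ge0.
rewrite -ler_pdivrMr// mulrC -frob_dotZr; apply: ub_le_sup.
  exists (C * `|Z|) => _ [V /= NV <-].
  apply: le_trans (ler_norm _) _; apply: le_trans (fC _ _) _.
  by rewrite ler_piMr// mulr_ge0.
exists ((N X)^-1 *: X) => //=.
by rewrite NZ ger0_norm ?invr_ge0 ?is_norm_ge0// mulVf.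
Qed.

End NormEquivalence.

(** * Gradients from quadratic remainders *)

(** Both gradients of the algorithm, of a quadratic loss and of a smooth
    conjugate function, come with a quadratic error bound, which avoids handling
    little-o terms twice. *)
Lemma gradient_unique {R : realType} {p q : nat} (g : 'M[R]_(p, q) -> R)
    (X G : 'M[R]_(p, q)) (C : R) :
    (forall V, `|g (X + V) - g X - frob_dot G V| <= C * `|V| ^+ 2) ->
  gradient g X = G.
Proof.
move=> gG; have cG : continuous (frob_dot G : 'M[R]_(p, q) -> R^o).
  have [c c0 fc] := @frob_dot_bound R p q.
  apply: (@lipschitz_continuous R 'M[R]_(p, q) R^o (frob_dot G) (c * `|G|)).
  move=> U V.
  by rewrite -frob_dotBr; exact: fc.
suff dg : 'd (g : _ -> R^o) X = frob_dot G :> (_ -> R^o).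
  apply/matrixP => i j; rewrite mxE.
  transitivity (frob_dot G (delta_mx i j)); first by rewrite -dg.
  rewrite frob_dotE (bigD1 i)//= (bigD1 j)//= mxE !eqxx mulr1.
  rewrite !big1 ?addr0// => [i' /negPf i'i|j' /negPf j'j].
    by rewrite big1// => j' _; rewrite mxE i'i mulr0.
  by rewrite mxE j'j andbF mulr0.
apply: (diff_unique cG); apply/eqaddoP => e e0; near=> V.
rewrite /= !fctE opprD addrA (addrC V X).
apply: le_trans (gG V) _; rewrite expr2 mulrA ler_wpM2r//.
apply: (@le_trans _ _ ((`|C| + 1) * `|V|)).
  by apply: ler_wpM2r => //; rewrite (le_trans (ler_norm C))// lerDl.
rewrite -ler_pdivlMl ?ltr_wpDl//.
near: V; apply: (@nbhs0_le R 'M[R]_(p, q)).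
by rewrite mulr_gt0// invr_gt0 ltr_wpDl.
Unshelve. all: by end_near. Qed.

(** * Subgradients and the conjugate function *)

(** If no point were minimal, every x in K would have a neighbourhood on which
    g exceeds the value at some w of K.  By compactness one w serves all of K,
    itself included.  The compactness argument runs along the filter F of the
    sets that contain all points of K of sufficiently low value. *)
Lemma lsc_compact_min {R : realType} (T : topologicalType) (g : T -> \bar R)
    (K : set T) :
    lower_semicontinuous g -> compact K -> K !=set0 ->
  exists2 x, K x & forall y, K y -> (g x <= g y)%E.
Proof.
move=> gl /compact_near_coveringP cK [x0 Kx0]; apply: contrapT => nomin.
have below x : K x -> exists2 y, K y & (g y < g x)%E.
  move=> Kx; apply: contrapT => nox; apply: nomin; exists x => // y Ky.
  by rewrite leNgt; apply/negP => gyx; apply: nox; exists y.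
pose F : set_system T :=
  [set A | exists2 y, K y & forall z, K z -> (g z <= g y)%E -> A z].
have FF : Filter F.
  split=> [|A B [y Ky yA] [z Kz zB]|A B AB [y Ky yA]].
  - by exists x0.
  - have [yz|/ltW zy] := leP (g y) (g z); [exists y|exists z] => // w Kw wyz.
      by split; [exact: yA|exact: zB (le_trans wyz _)].
    by split; [exact: yA (le_trans wyz _)|exact: zB].
  - by exists y => // z Kz zy; apply: AB; exact: yA.
have [|y Ky /(_ y Ky (lexx _) y Ky)] := cK T F (fun z x => g z < g x)%E FF;
  last by rewrite ltxx.
move=> x Kx; have [y Ky gyx] := below x Kx.
(* Lower semicontinuity is stated with real thresholds, while g y may be -oo;
   a second step down leaves room for a real number. *)
have [w Kw gwy] := below y Ky.
have [r wr ry] : exists2 r : R, (g w <= r%:E)%E & (r%:E < g x)%E.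
  case: (g y) gyx gwy => [r| |]; last by move=> _; rewrite ltNge leNye.
    by move=> rx wr; exists r => //; exact: ltW.
  by rewrite ltNge leey.
have [V xV Vr] := gl x r ry.
exists (V, [set z | K z /\ (g z <= g w)%E]); first split => //=.
  by exists w.
move=> [v z] /= [Vv [Kz zw]].
by rewrite (le_lt_trans zw)// (le_lt_trans wr)// Vr.
Qed.

Section Conjugate.
Context {R : realType} {p q : nat}.
Implicit Types (f : 'M[R]_(p, q) -> \bar R) (N : 'M[R]_(p, q) -> R).
Implicit Types (P Q X W Z : 'M[R]_(p, q)).

Lemma subdiff_fin_num f Q Z :
  proper_fun f -> subdiff f Q Z -> f Q \is a fin_num.
Proof.
move=> [fNy [P domP]] QZ; rewrite fin_numE fNy /=.
apply: contraTneq domP => fQ; rewrite /dom /= -leNgt.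
by have := QZ P; rewrite fQ addye.
Qed.

Lemma dom_fin_num f X : proper_fun f -> dom f X -> f X \is a fin_num.
Proof. by move=> [fNy _] domX; rewrite fin_numE fNy /= -ltey. Qed.

Lemma fin_num_dom f X : f X \is a fin_num -> dom f X.
Proof. by rewrite /dom /= ltey fin_numE => /andP[]. Qed.

Lemma lsc_tilt f Z : proper_fun f -> lower_semicontinuous f ->
  lower_semicontinuous (fun X => f X - (frob_dot Z X)%:E)%E.
Proof.
move=> [fNy _] fl X a aX.
have [b ab bX] : exists2 b : R, a + frob_dot Z X < b & (b%:E < f X)%E.
  move: aX; rewrite lteBrDr// -EFinD.
  case: (f X) (fNy X) => [r _| _ _|//].
    rewrite lte_fin => ar; exists ((a + frob_dot Z X + r) / 2).
      by rewrite midf_lt.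
    by rewrite lte_fin midf_lt.
  by exists (a + frob_dot Z X + 1); rewrite ?ltrDl ?ltry.
have [V XV Vb] := fl X b bX.
have [c c0 fc] := @frob_dot_bound R p q.
have cZ : continuous (frob_dot Z : 'M[R]_(p, q) -> R^o).
  apply: (@lipschitz_continuous R 'M[R]_(p, q) R^o (frob_dot Z) (c * `|Z|)).
  move=> P Q.
  by rewrite -frob_dotBr; exact: fc.
have ZX : nbhs X [set Y | frob_dot Z Y < b - a].
  have ZXb : frob_dot Z X < b - a by lra.
  exact: (cvgr_lt _ (cZ X) _ ZXb).
exists (V `&` [set Y | frob_dot Z Y < b - a]); first exact: filterI.
move=> Y [/Vb bY /= ZY]; rewrite EFinN lteBrDr// -EFinD.
by apply: lt_trans bY; rewrite lte_fin; lra.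
Qed.

(** The subgradient Z0 at Q0 bounds f below by a quadratic, hence f - <Z, .> has
    bounded sublevel sets.  A minimizer Q exists, and minimality at Q means that
    Z is a subgradient there. *)
Lemma subdiff_surjective N (mu : R) f Q0 Z0 Z :
    is_norm N -> proper_fun f -> lower_semicontinuous f -> 0 < mu ->
    strongly_convex N mu f -> subdiff f Q0 Z0 ->
  exists Q, subdiff f Q Z.
Proof.
move=> Nn fp fl mu0 fs Q0Z0.
have fQ0 := subdiff_fin_num fp Q0Z0.
have [c c0 cN] := is_norm_lower_bound Nn.
have [C C0 fC] := frob_dot_norm_bound Nn.
pose D := C * `|Z - Z0|.
(* On the sublevel set of Q0, n = N (X - Q0) satisfies mu / 2 * n^2 <= D * n,
   that is n <= 2 * D / mu; c converts this into a max-norm bound. *)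
pose K := [set X : 'M[R]_(p, q) | `|X| <= `|Q0| + c * (2 * D / mu)].
have D0 : 0 <= D by rewrite mulr_ge0.
have KQ0 : K Q0.
  by rewrite /K /= lerDl mulr_ge0 ?divr_ge0 ?mulr_ge0// ltW.
pose phi X := (f X - (frob_dot Z X)%:E)%E.
have sublevel X : (phi X <= phi Q0)%E -> K X.
  move=> XQ0.
  have fX : f X \is a fin_num.
    apply: dom_fin_num => //; rewrite /dom /= ltey; apply: contraTneq XQ0 => fX.
    by rewrite /phi fX -(fineK fQ0) -EFinB addye// -ltNge ltry.
  have := fs X Q0 Z0 (fin_num_dom fX) (fin_num_dom fQ0) Q0Z0.
  move: XQ0; rewrite /phi -(fineK fX) -(fineK fQ0) -!EFinB -!EFinD !lee_fin.
  move=> XQ0 strong.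
  have upper :
      frob_dot Z X - frob_dot Z Q0 - frob_dot Z0 (X - Q0) <= D * N (X - Q0).
    rewrite -frob_dotBr -frob_dotBl.
    exact: le_trans (ler_norm _) (fC _ _).
  have Nle : N (X - Q0) <= 2 * D / mu.
    rewrite ler_pdivlMr//.
    have [N0|N0] := leP (N (X - Q0)) 0.
      apply: (@le_trans _ _ 0); last by rewrite mulr_ge0.
      by rewrite mulr_le0_ge0// ltW.
    by rewrite -(ler_pM2l N0); nra.
  rewrite /K /= -(subrK Q0 X) addrC (le_trans (ler_normD _ _))// lerD2l.
  by rewrite (le_trans (cN _))// ler_wpM2l// ltW.
have [Q KQ minQ] : exists2 Q, K Q & forall P, K P -> (phi Q <= phi P)%E.
  apply: lsc_compact_min; [exact: lsc_tilt|exact: mx_ball_compact|].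
  by exists Q0.
have {}minQ P : (phi Q <= phi P)%E.
  have [/sublevel/minQ//|/ltW] := leP (phi P) (phi Q0).
  by apply: le_trans; exact: minQ.
exists Q => P; have := minQ P.
rewrite /phi leeBrDr// frob_dotBr EFinB.
by rewrite addeA (addeAC (f Q)).
Qed.

Lemma fenchel_young f Z X : ((frob_dot Z X)%:E - f X <= fenchel f Z)%E.
Proof.
have [domX|] := ltP (f X) +oo%E; first by apply: ereal_sup_ubound; exists X.
by rewrite leye_eq => /eqP ->; rewrite addeNy leNye.
Qed.

Lemma fenchel_subdiff f Q Z : proper_fun f -> subdiff f Q Z ->
  fenchel f Z = ((frob_dot Z Q)%:E - f Q)%E.
Proof.
move=> fp QZ; have fQ := subdiff_fin_num fp QZ.
apply/eqP; rewrite eq_le fenchel_young andbT.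
apply: ge_ereal_sup => _ [P domP <-].
have := QZ P; have fP := dom_fin_num fp domP.
rewrite -(fineK fP) -(fineK fQ) -!EFinB -EFinD !lee_fin frob_dotBr; lra.
Qed.

Lemma fenchel_subdiff_fin_num f Q Z : proper_fun f -> subdiff f Q Z ->
  fenchel f Z \is a fin_num.
Proof.
move=> fp QZ; rewrite (fenchel_subdiff fp QZ).
by rewrite -(fineK (subdiff_fin_num fp QZ)) -EFinB.
Qed.

(** By strong convexity <Z + W, P> - f P is at most
    f^*(Z) + <W, Q> + c n - mu / 2 n^2 with n = N (P - Q), and the quadratic in
    n is at most c^2 / (2 mu).  Any bound c for W in the dual norm will do: the
    dual norm itself in the descent step, a multiple of the max norm for
    differentiability. *)
Lemma fenchel_smooth N (mu c : R) f Q Z W :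
    proper_fun f -> 0 < mu -> strongly_convex N mu f -> subdiff f Q Z ->
    (forall V, frob_dot W V <= c * N V) ->
  (fenchel f (Z + W) <=
     fenchel f Z + (frob_dot W Q + c ^+ 2 / (2 * mu))%:E)%E.
Proof.
move=> fp mu0 fs QZ Wc; have fQ := subdiff_fin_num fp QZ.
apply: ge_ereal_sup => _ [P domP <-]; have fP := dom_fin_num fp domP.
have := fs P Q Z domP (fin_num_dom fQ) QZ; rewrite (fenchel_subdiff fp QZ).
rewrite -(fineK fP) -(fineK fQ) -!EFinB -!EFinD !lee_fin.
have := Wc (P - Q); rewrite !frob_dotBr !frob_dotDl => WPQ strong.
have young : c * N (P - Q) <= mu / 2 * N (P - Q) ^+ 2 + c ^+ 2 / (2 * mu).
  rewrite -subr_ge0.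
  have -> : mu / 2 * N (P - Q) ^+ 2 + c ^+ 2 / (2 * mu) - c * N (P - Q) =
      (mu * N (P - Q) - c) ^+ 2 / (2 * mu) by field; rewrite gt_eqF.
  by rewrite divr_ge0 ?sqr_ge0// mulr_ge0// ltW.
lra.
Qed.

(** The remainder f^*(Z + V) - f^*(Z) - <V, Q> is nonnegative by the
    Fenchel-Young inequality at Q and at most quadratic in V by smoothness. *)
Lemma gradient_fenchel N (mu : R) f Q Z :
    is_norm N -> proper_fun f -> lower_semicontinuous f -> 0 < mu ->
    strongly_convex N mu f -> subdiff f Q Z ->
  gradient (fine \o fenchel f) Z = Q.
Proof.
move=> Nn fp fl mu0 fs QZ; have [C C0 fC] := frob_dot_norm_bound Nn.
apply: (@gradient_unique _ _ _ _ _ _ (C ^+ 2 / (2 * mu))) => V.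
have [Q' Q'ZV] := subdiff_surjective (Z + V) Nn fp fl mu0 fs QZ.
have fZV := fenchel_subdiff_fin_num fp Q'ZV.
have fZ := fenchel_subdiff_fin_num fp QZ.
have : (fenchel f (Z + V) <=
    fenchel f Z + (frob_dot V Q + (C * `|V|) ^+ 2 / (2 * mu))%:E)%E.
  apply: (fenchel_smooth fp mu0 fs QZ) => X.
  exact: le_trans (ler_norm _) (fC _ _).
have : ((frob_dot (Z + V) Q)%:E - f Q <= fenchel f (Z + V))%E.
  exact: fenchel_young.
rewrite frob_dotDl /= EFinD addeAC -(fenchel_subdiff fp QZ).
rewrite -(fineK fZV) -(fineK fZ) -!EFinD !lee_fin /= => lo up.
have -> : C ^+ 2 / (2 * mu) * `|V| ^+ 2 = (C * `|V|) ^+ 2 / (2 * mu).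
  by rewrite exprMn mulrAC.
by rewrite ger0_norm (frob_dotC Q); lra.
Qed.

End Conjugate.

(** * The regret bound *)

(** The Cauchy-Schwarz inequality for the square roots of b and d, stated so
    that no square root occurs. *)
Lemma sqr_sum_le {R : realFieldType} (a b d : nat -> R) (T : nat) :
    (forall t, 0 <= b t) -> (forall t, 0 <= d t) ->
    (forall t, a t ^+ 2 <= b t * d t) ->
  (\sum_(0 <= t < T) a t) ^+ 2 <=
  (\sum_(0 <= t < T) b t) * \sum_(0 <= t < T) d t.
Proof.
move=> b0 d0 abd; elim: T => [|T IH]; first by rewrite !big_geq// expr2 mulr0.
rewrite !big_nat_recr//=.
have : 0 <= \sum_(0 <= t < T) b t by exact: sumr_ge0.
have : 0 <= \sum_(0 <= t < T) d t by exact: sumr_ge0.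
move: (\sum_(0 <= t < T) a t) (\sum_(0 <= t < T) b t)
  (\sum_(0 <= t < T) d t) IH => x y z xyz z0 y0.
move: (a T) (b T) (d T) (b0 T) (d0 T) (abd T) => u v w v0 w0 uvw.
(* (x u)^2 <= (y w) (v z), so this is the inequality of the two means *)
have cross : 2 * (x * u) <= y * w + v * z.
  apply: le_trans (ler_norm _) _.
  rewrite -ler_sqr ?nnegrE ?addr_ge0 ?mulr_ge0// real_normK ?num_real//.
  have : (x * u) ^+ 2 <= (y * z) * (v * w).
    by rewrite exprMn ler_pM ?sqr_ge0.
  have := sqr_ge0 (y * w - v * z); nra.
by rewrite sqrrD mulrDl !mulrDr -mulr_natl; nra.
Qed.

Section Loss.
Context {R : realType} {n1 n2 m k : nat}.
Variables (B : {linear 'M[R]_(m, n2) -> 'M[R]_(n1, n2)}) (Theta : 'M[R]_(m, k)).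
Implicit Types (psi : 'M[R]_(k, n2)) (That V : 'M[R]_(m, k)).

Lemma loss_ge0 psi That : 0 <= loss B Theta psi That.
Proof. by rewrite mulr_ge0 ?invr_ge0 ?sqr_ge0. Qed.

(** The gradient of the loss is minus the adjoint of B applied to the residual,
    times psi^T; pairing it with V avoids introducing the adjoint. *)
Lemma frob_dot_loss_grad psi That V :
  frob_dot (loss_grad B Theta psi That) V =
  - frob_dot (B ((Theta - That) *m psi)) (B (V *m psi)).
Proof.
pose E := B ((Theta - That) *m psi).
pose L (V : 'M[R]_(m, k)) : R^o := - frob_dot E (B (V *m psi)).
have Llin : linear L.
  move=> a U W; rewrite /L mulmxDl -scalemxAl linearP frob_dotDr frob_dotZr.
  by rewrite opprD scalerN.
pose LL : {linear 'M[R]_(m, k) -> R^o} :=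
  HB.pack L (GRing.isLinear.Build _ _ _ _ _ Llin).
have [c c0 BC] : exists2 c : R, 0 <= c & forall U, `|B (U *m psi)| <= c * `|U|.
  apply: (@seminorm_bound _ _ _ (fun U => `|B (U *m psi)|)) => [U W|a U].
    by rewrite mulmxDl linearD ler_normD.
  by rewrite -scalemxAl linearZ normrZ.
have [C C0 fC] := @frob_dot_bound R n1 n2.
rewrite -/E -[RHS]/(LL V) (linear_frob_dot LL V); congr frob_dot.
apply: (@gradient_unique _ _ _ _ _ _ (2^-1 * (C * c ^+ 2))) => U.
rewrite -linear_frob_dot /loss !sqr_frob_norm.
have -> : B ((Theta - (That + U)) *m psi) = E - B (U *m psi).
  by rewrite -linearB -mulmxBl opprD addrA.
rewrite -/E frob_dotBr !frob_dotBl (frob_dotC _ E).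
have -> : LL U = - frob_dot E (B (U *m psi)) by [].
set s := frob_dot E E; set t := frob_dot E _.
set r := frob_dot (B _) _.
have -> : 2^-1 * (s - t - (t - r)) - 2^-1 * s - - t = 2^-1 * r by field.
rewrite normrM ger0_norm ?invr_ge0// -mulrA ler_wpM2l ?invr_ge0//.
apply: le_trans (fC _ _) _.
have -> : C * c ^+ 2 * `|U| ^+ 2 = C * (c * `|U|) * (c * `|U|) by ring.
by rewrite !ler_pM ?mulr_ge0.
Qed.

(** Taking V to be the error itself recovers the squared residual: the factor 2
    is Euler's identity for the quadratic loss. *)
Lemma frob_dot_loss_grad_error psi That :
  frob_dot (loss_grad B Theta psi That) (Theta - That) =
  - (2 * loss B Theta psi That).
Proof.
by rewrite frob_dot_loss_grad /loss sqr_frob_norm mulrA divff ?mul1r ?pnatr_eq0.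
Qed.

Lemma step_size_ge0 N mu eps psi That : 0 < mu -> 0 <= eps ->
  0 <= step_size B Theta N mu eps psi That.
Proof.
move=> mu0 eps0; rewrite /step_size; case: ifP => // _.
apply: divr_ge0; last by rewrite addr_ge0 ?sqr_ge0.
by apply: mulr_ge0 (loss_ge0 _ _); rewrite mulr_ge0// ltW.
Qed.

(** The convention for a vanishing denominator d is harmless: the gradient then
    has dual norm zero, and pairing it with the error shows that the loss
    vanishes too. *)
Lemma step_sizeM N mu eps psi That : is_norm N -> 0 <= eps ->
  step_size B Theta N mu eps psi That *
    (eps + dual_norm N (loss_grad B Theta psi That) ^+ 2) =
  2 * mu * loss B Theta psi That.
Proof.
move=> Nn eps0; rewrite /step_size; set d := eps + _.
have [d0|d0] := eqVneq d 0; last by rewrite divfK.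
have g0 : dual_norm N (loss_grad B Theta psi That) = 0.
  move/eqP: d0; rewrite paddr_eq0 ?sqr_ge0// sqrf_eq0.
  by case/andP => _ /eqP.
have := frob_dot_le_dual_norm (loss_grad B Theta psi That) (Theta - That) Nn.
rewrite g0 mul0r normr_le0 frob_dot_loss_grad_error oppr_eq0 mulf_eq0.
by rewrite pnatr_eq0 /= => /eqP ->; rewrite mul0r mulr0.
Qed.

(** With f Theta added to both sides, this is the decrease by eta J of the
    Bregman divergence.  The linear term of the smoothness bound contributes
    - 2 eta J, and the quadratic one eta^2 s^2 / (2 mu) <= eta J, where s is the
    dual norm of g, because eta (eps + s^2) = 2 mu J. *)
Lemma mirror_descent_step N mu f Z eps psi That :
    let J := loss B Theta psi That in
    let g := loss_grad B Theta psi That in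
    let eta := step_size B Theta N mu eps psi That in
    is_norm N -> proper_fun f -> 0 < mu -> strongly_convex N mu f ->
    0 <= eps -> subdiff f That Z ->
  (fenchel f (Z - eta *: g) - (frob_dot Theta (Z - eta *: g))%:E <=
     fenchel f Z - (frob_dot Theta Z)%:E - (eta * J)%:E)%E.
Proof.
move=> J g eta Nn fp mu0 fs eps0 ZThat.
pose s := dual_norm N g.
have fZ := fenchel_subdiff_fin_num fp ZThat.
have : (fenchel f (Z - eta *: g) <= fenchel f Z +
    (frob_dot (- (eta *: g)) That + (`|eta| * s) ^+ 2 / (2 * mu))%:E)%E.
  apply: (fenchel_smooth fp mu0 fs ZThat) => V.
  apply: le_trans (ler_norm _) _.
  rewrite frob_dotNl frob_dotZl normrN normrM -mulrA ler_wpM2l//.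
  exact: frob_dot_le_dual_norm.
rewrite -(fineK fZ); case: (fenchel f (Z - _)) => [r| |]; last 2 first.
- by rewrite -EFinD leye_eq.
- by move=> _; rewrite addNye leNye.
rewrite -!EFinB -!EFinD !lee_fin => up.
apply: le_trans (lerB up (lexx _)) _.
rewrite frob_dotBr frob_dotNl frob_dotZl frob_dotZr.
have := frob_dot_loss_grad_error psi That; rewrite -/J -/g frob_dotBr.
rewrite (frob_dotC g Theta) => gE.
have sd : (`|eta| * s) ^+ 2 / (2 * mu) <= eta * J.
  rewrite ler_pdivrMr ?mulr_gt0// exprMn real_normK ?num_real//.
  have -> : eta * J * (2 * mu) = eta * (2 * mu * J) by ring.
  rewrite -(step_sizeM mu psi That Nn eps0) -/eta -/g mulrA -expr2.
  by rewrite ler_wpM2l ?sqr_ge0// lerDr.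
nra.
Qed.

End Loss.

Theorem theorem3 (R : realType) (n1 n2 m k : nat)
  (n1_gt0 : (0 < n1)%N) (n2_gt0 : (0 < n2)%N)
  (m_gt0 : (0 < m)%N) (k_gt0 : (0 < k)%N)
  (A : {linear 'M[R]_(n1, n2) -> 'M[R]_(n1, n2)})
  (B : {linear 'M[R]_(m, n2) -> 'M[R]_(n1, n2)})
  (K : {linear 'M[R]_(n1, n2) -> 'M[R]_(m, n2)})
  (ABK_stable : schur_stable (fun X : 'M[R]_(n1, n2) => A X - B (K X)))
  (Psi : 'M[R]_(n1, n2) -> nat -> 'M[R]_(k, n2))
  (Ud : nat -> 'M[R]_(m, n2))
  (Ud_bounded : exists C : R, forall t, frob_norm (Ud t) <= C)
  (Omega : set 'M[R]_(m, k)) (Theta : 'M[R]_(m, k))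
  (Theta_in : Omega Theta)
  (N : 'M[R]_(m, k) -> R) (N_norm : is_norm N)
  (f : 'M[R]_(m, k) -> \bar R)
  (f_proper : proper_fun f) (f_lsc : lower_semicontinuous f)
  (f_convex : econvex f) (Omega_dom : Omega `<=` dom f)
  (mu : R) (mu_gt0 : 0 < mu) (f_strong : strongly_convex N mu f)
  (eps : nat -> R) (eps_ge0 : forall t, 0 <= eps t.+1)
  (eps_bounded : exists C : R, forall t, eps t.+1 <= C)
  (X : nat -> 'M[R]_(n1, n2)) (U : nat -> 'M[R]_(m, n2))
  (That Z : nat -> 'M[R]_(m, k)) (eta : nat -> R)
  (X_rec : forall t, X t.+1 = A (X t) + B (Theta *m Psi (X t) t + U t))
  (U_def : forall t, U t = - K (X t) - That t *m Psi (X t) t + Ud t)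
  (Z0_subdiff : subdiff f (That 0%N) (Z 0%N))
  (eta_def : forall t,
     eta t.+1 = step_size B Theta N mu (eps t.+1) (Psi (X t) t) (That t))
  (Z_rec : forall t,
     Z t.+1 = Z t - eta t.+1 *: loss_grad B Theta (Psi (X t) t) (That t))
  (That_rec : forall t, That t.+1 = gradient (fine \o fenchel f) (Z t.+1))
  (T : nat) (T_gt0 : (1 <= T)%N) :
  \sum_(0 <= t < T) loss B Theta (Psi (X t) t) (That t) <=
  Num.sqrt (fine (bregman f Theta (That 0%N) (Z 0%N)) / (2 * mu) *
    \sum_(0 <= t < T)
      (eps t.+1 + dual_norm N (loss_grad B Theta (Psi (X t) t) (That t)) ^+ 2)).
Proof.
pose J t := loss B Theta (Psi (X t) t) (That t).
pose d t :=
  eps t.+1 + dual_norm N (loss_grad B Theta (Psi (X t) t) (That t)) ^+ 2.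
have d_ge0 t : 0 <= d t by rewrite addr_ge0 ?sqr_ge0.
have J_ge0 t : 0 <= J t by exact: loss_ge0.
have eta_ge0 t : 0 <= eta t.+1 by rewrite eta_def step_size_ge0.
have eta_d t : eta t.+1 * d t = 2 * mu * J t by rewrite eta_def step_sizeM.
have Z_subdiff t : subdiff f (That t) (Z t).
  case: t => [//|t].
  have [Q QZ] := subdiff_surjective (Z t.+1) N_norm f_proper f_lsc mu_gt0
    f_strong Z0_subdiff.
  rewrite That_rec.
  by rewrite (gradient_fenchel N_norm f_proper f_lsc mu_gt0 f_strong QZ).
have fTheta : f Theta \is a fin_num.
  by apply: dom_fin_num => //; exact: Omega_dom.
have fenchel_fin t : fenchel f (Z t) \is a fin_num.
  exact: fenchel_subdiff_fin_num (Z_subdiff t).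
pose D t := fine (bregman f Theta (That t) (Z t)).
have DE t :
    D t = fine (f Theta) + fine (fenchel f (Z t)) - frob_dot Theta (Z t).
  by rewrite /D /bregman -(fineK fTheta) -(fineK (fenchel_fin t)).
have D_ge0 t : 0 <= D t.
  have := fenchel_young f (Z t) Theta; rewrite DE -(fineK fTheta).
  by rewrite -(fineK (fenchel_fin t)) -EFinB lee_fin frob_dotC /=; lra.
have D_step t : D t.+1 <= D t - eta t.+1 * J t.
  have := mirror_descent_step B Theta (Psi (X t) t) N_norm f_proper mu_gt0
    f_strong (eps_ge0 t) (Z_subdiff t).
  rewrite /= -eta_def -Z_rec !DE -(fineK (fenchel_fin t)).
  by rewrite -(fineK (fenchel_fin t.+1)) -!EFinB lee_fin /= -/(J t); lra.
have D_sum : \sum_(0 <= t < T) eta t.+1 * J t <= D 0%N.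
  suff : \sum_(0 <= t < T) eta t.+1 * J t <= D 0%N - D T.
    by move/le_trans; apply; rewrite gerBl.
  elim: (T) => [|t IH]; first by rewrite big_geq// subrr.
  rewrite big_nat_recr//=; have := D_step t; lra.
have J_sum : 0 <= \sum_(0 <= t < T) J t by exact: sumr_ge0.
rewrite -(ger0_norm J_sum) -sqrtr_sqr ler_sqrt; last first.
  apply: mulr_ge0; last by apply: sumr_ge0 => t _; exact: d_ge0.
  apply: (divr_ge0 (D_ge0 0%N)); apply: mulr_ge0 => //; exact: ltW.
apply: (@le_trans _ _ ((\sum_(0 <= t < T) (eta t.+1 * J t / (2 * mu))) *
    \sum_(0 <= t < T) d t)).
  apply: sqr_sum_le => // t.
    by apply: divr_ge0; apply: mulr_ge0; rewrite // ltW.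
  have -> : eta t.+1 * J t / (2 * mu) * d t =
      (eta t.+1 * d t) * (J t / (2 * mu)) by ring.
  rewrite eta_d le_eqVlt; apply/orP; left; apply/eqP; field.
  by rewrite gt_eqF.
rewrite -mulr_suml; apply: ler_wpM2r.
  by apply: sumr_ge0 => t _; exact: d_ge0.
by apply: ler_wpM2r => //; rewrite invr_ge0 mulr_ge0// ltW.
Qed.
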